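(* For a prime $p$ and integers $2\le r\le s$, $$E^{(r)}_{\max}(p^s)\le 2(p-1)p^{s-1}\Big(r-(p-1)\big(r-1+\tilde{\mu}_p(s-1,r)\big)\tilde{\mu}_p(s-1,r)\Big),$$ where $\tilde{\mu}_p(s-1,r):=\tilde{\nu}/(1-\tilde{\nu})$ and $\tilde{\nu}$ is the unique real solution $x\in[0,1]$ of $p^{s-1}x^{r-1}=(1-x)^2$.
   Context: For a positive integer $n$ and a set $\mathcal{D}$ of positive divisors of $n$ with $n\notin\mathcal{D}$, the integral circulant (gcd) graph $\mathrm{ICG}_n(\mathcal{D})$ has vertex set $\mathbb{Z}_n$ and edge set $\{\{a,b\}: a,b\in\mathbb{Z}_n,\ \gcd(a-b,n)\in\mathcal{D}\}$. The energy of a graph is the sum of the absolute values of the eigenvalues of its adjacency matrix; write $E_n(\mathcal{D})$ for the energy of $\mathrm{ICG}_n(\mathcal{D})$. Define $E^{(r)}_{\max}(n):=\max\{E_n(\mathcal{D}):\ \mathcal{D}\subseteq\{1\le d<n: d\mid n\},\ |\mathcal{D}|=r\}$. *)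

(* Defs.v *)
From mathcomp Require Import all_boot all_order all_algebra.
From mathcomp Require Import reals complex.

Set Implicit Arguments.
Unset Strict Implicit.
Unset Printing Implicit Defensive.

Import Order.TTheory GRing.Theory Num.Theory.
Local Open Scope ring_scope.

(* The vertices 'I_n are the representatives 0, ..., n - 1 of Z/nZ (the type
   'Z_n would be wrong for n = 1); gcd(a - b, n) does not depend on the choice
   of representatives.  As n is not in D, a set D of divisors can be taken in
   {set 'I_n}, and a = b, where the gcd is n, is never adjacent. *)
Definition icg (n : nat) (D : {set 'I_n}) : rel 'I_n :=
  fun a b => [exists d in D, gcdn `|a%:Z - b%:Z|%N n == d].

Definition proper_divisors (n : nat) : {set 'I_n} :=
  [set d : 'I_n | (0 < d)%N && (d %| n)%N].

Definition adjacency_mx (R : realType) (n : nat) (e : rel 'I_n) : 'M[R]_n :=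
  \matrix_(i, j) (e i j)%:R.

(* All complex eigenvalues, repeated according to algebraic multiplicity:
   the roots of the characteristic polynomial, which is monic. *)
Definition eigenvalues (R : realType) (n : nat) (A : 'M[R]_n) : seq R[i] :=
  sval (closed_field_poly_normal (char_poly (map_mx (real_complex R) A))).

(* [normc] is the modulus with values in R (the norm of R[i] lands in R[i]). *)
Definition energy (R : realType) (n : nat) (e : rel 'I_n) : R :=
  \sum_(z <- eigenvalues (adjacency_mx R e)) Normc.normc z.

(* Energies are nonnegative, so the default value 0 does not affect the
   maximum unless no D of cardinality r exists. *)
Definition Emax (R : realType) (r n : nat) : R :=
  \big[Num.max/0]_(D : {set 'I_n} | (D \subset proper_divisors n)
                                    && (#|D| == r)) energy R (icg D).

Definition nu_equation (R : realType) (p m r : nat) (x : R) : Prop :=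
  0 <= x <= 1 /\ p%:R ^+ m * x ^+ (r - 1) = (1 - x) ^+ 2.

Definition mu_tilde (R : realType) (nu : R) : R := nu / (1 - nu).

(* Main.v *)
Require Import Defs.
From mathcomp Require Import all_boot all_order all_algebra.
From mathcomp Require Import cyclic separable cyclotomic.
From mathcomp Require Import reals complex exp.
From mathcomp Require Import ring lra zify.

Set Implicit Arguments.
Unset Strict Implicit.
Unset Printing Implicit Defensive.

Import Order.TTheory GRing.Theory Num.Theory.
Local Open Scope ring_scope.

(** Let P be the set of v < s with p^(s-1-v) in D.  The Fourier matrix
    diagonalises the circulant adjacency matrix; the eigenvalue at a frequency
    of p-adic valuation u is (p-1) S_u - [u in P] p^u, where S_u is the sum of
    the p^k with k < u in P, hence it is negative exactly when u < s is in P.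
    As the eigenvalues add up to 0, the energy is
    2 (p-1) p^(s-1) (r - (p-1) h) with h the sum of A_v = S_v / p^v over v in P.

    To bound h from below, note that A_v / (1 + A_v) = S_v / S_(v+1) telescopes
    along P.  The tangent of ln (a / (1 + a)) at mu is used for all elements of
    P but the first and the last, and the tangent of ln at lam = mu (1 + mu) for
    the last one; both have slope 1 / lam, so the weighted sum collapses to
    h >= (r-2) mu + lam when nu = mu / (1 + mu) solves the equation. *)

(** * Weighted pair sums and tangents of the logarithm *)

Lemma big_ord_recr_cond (T : Type) (idx : T) (op : Monoid.law idx)
    (P : pred nat) (F : nat -> T) v :
  \big[op/idx]_(i < v.+1 | P i) F i
  = op (\big[op/idx]_(i < v | P i) F i) (if P v then F v else idx).
Proof. by rewrite big_mkcond big_ord_recr -big_mkcond. Qed.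

Lemma ln_sub_le (R : realType) (a b : R) :
  0 < a -> 0 < b -> ln a - ln b <= a / b - 1.
Proof.
move=> a0 b0; rewrite -ln_div ?posrE// -{1}[a / b](subrK 1) addrC.
by rewrite le_ln1Dx// ltrBrDr addrC subrr divr_gt0.
Qed.

(* Tangent line at mu of the concave function a |-> ln (a / (1 + a)). *)
Lemma ln_ratio_tangent (R : realType) (a mu : R) : 0 < a -> 0 < mu ->
  mu * (1 + mu) * (ln a - ln (1 + a) - ln (mu / (1 + mu))) <= a - mu.
Proof.
move=> a0 mu0; have a1 : 0 < 1 + a by lra.
have mu1 : 0 < 1 + mu by lra.
have := @ln_sub_le R (a * (1 + mu)) (mu * (1 + a)).
rewrite !mulr_gt0// => /(_ isT isT).
rewrite ln_div ?posrE// !lnM ?posrE// => le1.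
apply: (@le_trans _ _ (mu * (1 + mu) * (a * (1 + mu) / (mu * (1 + a)) - 1))).
  by rewrite ler_pM2l ?mulr_gt0//; lra.
rewrite -subr_ge0.
have -> : a - mu - mu * (1 + mu) * (a * (1 + mu) / (mu * (1 + a)) - 1)
          = (a - mu) ^+ 2 / (1 + a) by field; rewrite !gt_eqF.
by rewrite divr_ge0 ?sqr_ge0// ltW.
Qed.

Section WeightedPairs.

Context {R : realType} (P : pred nat) (x : nat -> R) (mu : R).
Hypotheses (x_ge1 : forall i, 1 <= x i) (mu_gt0 : 0 < mu).

Let S v := \sum_(k < v | P k) x k.
Let N v := (\sum_(i < v | P i) 1)%N.
Let nu := mu / (1 + mu).
Let lam := mu * (1 + mu).

Let x_gt0 i : 0 < x i. Proof. exact: lt_le_trans (x_ge1 i). Qed.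

Let NS v : N v.+1 = (N v + P v)%N.
Proof.
rewrite /N (big_ord_recr_cond addn P (fun=> 1%N)) /=.
by case: (P v).
Qed.

Let SS v : S v.+1 = S v + (if P v then x v else 0).
Proof. exact: (big_ord_recr_cond +%R). Qed.

Let S_ge1 v : (0 < N v)%N -> 1 <= S v.
Proof.
elim: v => [|v IH]; first by rewrite /N big_ord0.
rewrite NS SS; case: (P v); last by rewrite addn0 addr0.
by move=> _; apply: ler_wpDl => //; apply: sumr_ge0 => i _; apply: ltW.
Qed.

(** The tangent bound at [mu] is summed over all but the first element of [P] below [v]; the
    logarithms telescope and only [ln (S v)] survives. *)
Lemma pair_sum_ge v : (0 < N v)%N ->
  ((N v)%:R - 1) * mu + lam * (- ln (S v) - ((N v)%:R - 1) * ln nu)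
  <= \sum_(i < v | P i) S i / x i.
Proof.
elim: v => [|v IH]; first by rewrite /N big_ord0.
rewrite NS SS (big_ord_recr_cond +%R P (fun i => S i / x i)).
have [Pv|_] := boolP (P v); last by rewrite /= addn0 !addr0.
(* At the first element of [P] no tangent is used: [x v >= 1] makes the logarithm nonnegative, so
   the left side is at most 0. *)
have [N0 _|Npos _] := posnP (N v).
  rewrite N0 add0n subrr !mul0r add0r subr0.
  have S0 i : 0 <= S i by apply: sumr_ge0 => j _; apply: ltW.
  apply: (@le_trans _ _ 0); last first.
    by rewrite addr_ge0 ?divr_ge0 ?(ltW (x_gt0 _))// sumr_ge0// => i _;
      rewrite divr_ge0 ?(ltW (x_gt0 _)).
  rewrite mulrN oppr_le0 !mulr_ge0 ?(ltW mu_gt0) ?addr_ge0 ?(ltW mu_gt0)//.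
  by rewrite ln_ge0// ler_wpDl.
have {IH} IH := IH Npos.
have Sv := lt_le_trans ltr01 (S_ge1 Npos).
have A0 : 0 < S v / x v by rewrite divr_gt0.
have := ln_ratio_tangent A0 mu_gt0.
have -> : 1 + S v / x v = (S v + x v) / x v by field; rewrite gt_eqF.
rewrite -/nu -/lam !(@ln_div _ _ (x v)) ?posrE ?addr_gt0//.
rewrite natrD /= => tg; lra.
Qed.

(** The induction only skips trailing indices outside [P]. At the last element of [P], the tangent
    of [ln] at [lam] cancels the [ln (S v)] left by [pair_sum_ge], and the weight there is replaced
    by its bound [X]. *)
Lemma pair_sum_ge_bounded v X : (1 < N v)%N -> (forall i, (i < v)%N -> x i <= X) ->
  ((N v)%:R - 2) * mu + lam
    + lam * (- ln X - ((N v)%:R - 2) * ln nu - ln lam)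
  <= \sum_(i < v | P i) S i / x i.
Proof.
elim: v => [|v IH]; first by rewrite /N big_ord0.
rewrite NS (big_ord_recr_cond +%R P (fun i => S i / x i)) => N1 xX.
have [Pv|Pv] := boolP (P v); last first.
  move: N1; rewrite (negbTE Pv) /= addn0 addr0 => N1.
  by apply: IH => // i iv; apply: xX; apply: ltnW.
have Npos : (0 < N v)%N by move: N1; rewrite Pv; lia.
have Sv := lt_le_trans ltr01 (S_ge1 Npos).
have lam0 : 0 < lam by rewrite mulr_gt0// addr_gt0.
have A0 : 0 < S v / x v by rewrite divr_gt0.
have le1 := pair_sum_ge Npos.
have : lam * (ln (S v / x v) - ln lam) <= lam * (S v / x v / lam - 1).
  by rewrite ler_pM2l// ln_sub_le.
have -> : lam * (S v / x v / lam - 1) = S v / x v - lam.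
  by field; rewrite !gt_eqF.
rewrite ln_div ?posrE// => le2.
have : lam * ln (x v) <= lam * ln X.
  rewrite ler_pM2l// ler_ln ?posrE ?xX//.
  exact: lt_le_trans (x_gt0 v) (xX v (ltnSn _)).
rewrite natrD /= => le3; lra.
Qed.

End WeightedPairs.

(** * The equation for [nu], and weights that are powers of [p] *)

Lemma nu_equation_exists_unique (R : realType) (p m r : nat) :
  (0 < p)%N -> (2 <= r)%N ->
  exists nu : R, [/\ 0 < nu < 1 & unique (nu_equation p m r) nu].
Proof.
move=> p0 r2; have pm0 : 0 < p%:R ^+ m :> R by rewrite exprn_gt0// ltr0n.
pose q : {poly R} := (p%:R ^+ m) *: 'X^(r - 1) - (1 - 'X) ^+ 2.
have qE x : q.[x] = p%:R ^+ m * x ^+ (r - 1) - (1 - x) ^+ 2.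
  by rewrite /q !hornerE.
have r10 : (r - 1 == 0)%N = false by lia.
(* Existence: [q] is -1 at 0 and [p ^ m] at 1. These values also keep the root off the endpoints. *)
have [|x /andP[x0 x1]] := @poly_ivt R q 0 1 ler01.
  rewrite !qE expr0n r10 mulr0 sub0r subr0 !expr1n subrr expr0n subr0 mulr1.
  by rewrite oppr_le0 ler01 ltW.
move=> /eqP; rewrite qE => /subr0_eq qx.
have xN1 : x != 1.
  apply/eqP => x1'; move: qx; rewrite x1' subrr expr1n expr0n /= mulr1 => pm.
  by move: pm0; rewrite pm ltxx.
have xN0 : x != 0.
  apply/eqP => x0'; move: qx; rewrite x0' subr0 expr1n expr0n r10 mulr0 => /eqP.
  by rewrite eq_sym oner_eq0.
(* Uniqueness: on [[0, 1]] the left side of the equation increases strictly while the right side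
   decreases. *)
have mono (a b : R) : 0 <= a -> a < b -> b <= 1 ->
    p%:R ^+ m * a ^+ (r - 1) = (1 - a) ^+ 2 ->
    p%:R ^+ m * b ^+ (r - 1) = (1 - b) ^+ 2 -> False.
  move=> age0 ab ble1 qa qb.
  have : p%:R ^+ m * a ^+ (r - 1) < p%:R ^+ m * b ^+ (r - 1).
    rewrite ltr_pM2l//; have := @ltrXn2r R (r - 1) a b age0 ab.
    by rewrite r10 => ->.
  have a1 : 0 <= 1 - a by lra.
  have b1 : 0 <= 1 - b by lra.
  by rewrite qa qb ltr_sqr// ltrD2l ltrN2 => /(lt_trans ab); rewrite ltxx.
exists x; split; first by rewrite lt_neqAle eq_sym xN0 x0 lt_neqAle xN1.
split=> [|y [/andP[y0 y1] qy]]; first by split; rewrite ?x0.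
apply/eqP/negPn/negP => /lt_total/orP[lt|lt].
  exact: mono lt _ qx qy.
exact: mono lt _ qy qx.
Qed.

Lemma prime_power_pair_sum_ge (R : realType) (P : pred nat) (p s r : nat) (nu : R) :
  (0 < p)%N -> (2 <= r)%N -> (\sum_(i < s | P i) 1)%N = r -> 0 < nu < 1 ->
  p%:R ^+ (s - 1) * nu ^+ (r - 1) = (1 - nu) ^+ 2 ->
  (r%:R - 1 + mu_tilde nu) * mu_tilde nu
  <= \sum_(i < s | P i) (\sum_(k < i | P k) p%:R ^+ k) / p%:R ^+ i.
Proof.
move=> p0 r2 Nr /andP[nu0 nu1] eqn.
have p1 : 1 <= p%:R :> R by rewrite ler1n.
have mu0 : 0 < mu_tilde nu by rewrite divr_gt0//; lra.
have x1 i : 1 <= p%:R ^+ i :> R by rewrite exprn_ege1.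
have xX i : (i < s)%N -> p%:R ^+ i <= p%:R ^+ (s - 1) :> R.
  by move=> ?; rewrite ler_weXn2l//; lia.
have N1 : (1 < \sum_(i < s | P i) 1)%N by rewrite Nr.
have := @pair_sum_ge_bounded R P (fun i => p%:R ^+ i) _ x1 mu0 s _ N1 xX.
rewrite Nr; apply: le_trans.
have nuN : 1 - nu != 0 by rewrite gt_eqF//; lra.
have -> : mu_tilde nu / (1 + mu_tilde nu) = nu.
  rewrite /mu_tilde; field; rewrite nuN /=.
  by rewrite gt_eqF//; lra.
have lamE : mu_tilde nu * (1 + mu_tilde nu) = nu / (1 - nu) ^+ 2.
  by rewrite /mu_tilde; field.
(* The logarithm of the equation for [nu]; it annihilates the bracket of logarithms in
   [pair_sum_ge_bounded] for [X = p ^ (s - 1)]. *)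
have ln0 : ln (p%:R ^+ (s - 1)) + (r%:R - 2) * ln nu
           + ln (nu / (1 - nu) ^+ 2) = 0.
  have -> : (r%:R - 2) * ln nu = ln (nu ^+ (r - 2)).
    by rewrite lnXn// -[RHS]mulr_natl natrB.
  have sq0 : 0 < (1 - nu) ^+ 2 by rewrite exprn_gt0//; lra.
  have pp : 0 < p%:R ^+ (s - 1) :> R by rewrite exprn_gt0// ltr0n.
  have nr0 : 0 < nu ^+ (r - 2) by rewrite exprn_gt0.
  have la0 : 0 < nu / (1 - nu) ^+ 2 by rewrite divr_gt0.
  rewrite -!lnM ?posrE ?(mulr_gt0 pp nr0) //.
  rewrite -mulrA [_ ^+ _ * (_ / _)]mulrA -exprSr.
  have -> : (r - 2).+1 = (r - 1)%N by lia.
  by rewrite mulrA eqn divff ?ln1// gt_eqF.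
rewrite lamE; set l := nu / (1 - nu) ^+ 2 in lamE ln0 *.
have -> : - ln (p%:R ^+ (s - 1)) - (r%:R - 2) * ln nu - ln l = 0.
  by rewrite -[RHS]oppr0 -[in RHS]ln0; ring.
rewrite mulr0 -lamE; lra.
Qed.

(** * Roots of unity and the spectrum of circulant matrices *)

Lemma prim_root_exists (F : closedFieldType) n :
  n%:R != 0 :> F -> exists w : F, n.-primitive_root w.
Proof.
move=> nF; have n_gt0 : (0 < n)%N by case: n nF => //; rewrite eqxx.
have [rs Drs] := closed_field_poly_normal ('X^n - 1 : {poly F}).
move: Drs; rewrite lead_coefXnsubC// scale1r => Drs.
have szrs : size rs = n.
  by apply: succn_inj; rewrite -(size_XnsubC (1 : F) n_gt0) Drs size_prod_XsubC.
suff /hasP[w _ prim_w] : has n.-primitive_root rs by exists w.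
apply: has_prim_root => //; last by rewrite szrs.
  apply/allP => z; rewrite -root_prod_XsubC -Drs.
  by rewrite unity_rootE rootE !hornerE subr_eq0.
by rewrite -separable_prod_XsubC -Drs separable_Xn_sub_1.
Qed.

Lemma big_dvdn (T : Type) (idx : T) (op : Monoid.law idx) (F : nat -> T) d q :
  (0 < d)%N ->
  \big[op/idx]_(x < d * q | (d %| x)%N) F x = \big[op/idx]_(y < q) F (d * y)%N.
Proof.
move=> d0; elim: q => [|q IH]; first by rewrite muln0 !big_ord0.
rewrite big_ord_recr /= -IH -!(big_mkord (fun x => d %| x)%N F) mulnS addnC.
rewrite (big_cat_nat (n := d * q)) ?leq_addr//=; congr (op _ _).
rewrite big_ltn_cond; last by lia.
rewrite dvdn_mulr// big_nat_cond big1 ?Monoid.mulm1// => x /andP[xlt /dvdnP[y xE]].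
by exfalso; move: xlt; rewrite {}xE; case: (leqP y q) => yq; nia.
Qed.

(** A geometric sum whose ratio [w ^+ (j * d)] is a [q]-th root of unity, equal to 1 exactly when
    [q] divides [j]. *)
Lemma prim_sum_dvd (F : fieldType) (n d q j : nat) (w : F) :
  n.-primitive_root w -> n = (d * q)%N ->
  \sum_(x < n | (d %| x)%N) w ^+ (j * x) = if (q %| j)%N then q%:R else 0.
Proof.
move=> prw nE; have n0 := prim_order_gt0 prw.
have /andP[d0 q0] : (0 < d)%N && (0 < q)%N by rewrite -muln_gt0 -nE.
have -> : \sum_(x < n | (d %| x)%N) w ^+ (j * x) = \sum_(y < q) (w ^+ (j * d)) ^+ y.
  rewrite nE (big_dvdn +%R (fun x => w ^+ (j * x)))//.
  by apply: eq_bigr => y _; rewrite mulnA exprM.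
have -> : (q %| j)%N = (w ^+ (j * d) == 1).
  by rewrite -(prim_order_dvd prw) nE mulnC dvdn_pmul2r.
have [->|wN1] := eqVneq (w ^+ (j * d)) 1.
  by under eq_bigr do rewrite expr1n; rewrite sumr_const card_ord.
have := subrX1 (w ^+ (j * d)) q; rewrite -exprM -mulnA -nE mulnC exprM.
rewrite (prim_expr_order prw) expr1n subrr => /esym/eqP.
by rewrite mulf_eq0 subr_eq0 (negbTE wN1) => /eqP.
Qed.

Lemma count_dvdn (d q : nat) : (0 < d)%N ->
  (\sum_(x < d * q | (d %| x)%N) 1)%N = q.
Proof. by move=> d0; rewrite (big_dvdn addn (fun=> 1%N))// sum1_card card_ord. Qed.

Lemma char_poly_similar (F : fieldType) n (A B P : 'M[F]_n) :
  P \in unitmx -> A *m P = P *m B -> char_poly A = char_poly B.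
Proof.
move=> Pu AP; rewrite /char_poly /char_poly_mx.
have Pu' : \det (map_mx (@polyC F) P) != 0.
  by rewrite det_map_mx polyC_eq0 -unitfE -unitmxE.
apply: (mulIf Pu'); rewrite [RHS]mulrC -!det_mulmx.
rewrite mulmxBl mulmxBr -!map_mxM AP; congr (\det (_ - _)).
by rewrite scalar_mxC.
Qed.

(** The columns of the Vandermonde matrix at the [w ^- j] are eigenvectors, since convolution with a
    character multiplies it by a Fourier coefficient; the matrix is invertible because these points
    are distinct. *)
Lemma char_poly_circulant (F : fieldType) n (f : nat -> F) (w : F) :
  n.+1.-primitive_root w ->
  char_poly (\matrix_(i < n.+1, j < n.+1) f ((i - j)%R : 'I_n.+1))
  = \prod_(j < n.+1) ('X - (\sum_(x < n.+1) f x * w ^+ (j * x))%:P).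
Proof.
move=> prw; have wn := prim_expr_order prw.
have w0 : w != 0.
  by apply/eqP => w0; move/eqP: wn; rewrite w0 expr0n eq_sym oner_eq0.
pose a : 'rV[F]_n.+1 := \row_j w ^- j.
pose d : 'rV[F]_n.+1 := \row_j \sum_(x < n.+1) f x * w ^+ (j * x).
(* Addition in ['I_n.+1] wraps around, which is harmless in exponents of [w]. *)
have wD (j : nat) (x y : 'I_n.+1) : w ^+ (j * (x + y)%R) = w ^+ (j * x) * w ^+ (j * y).
  by rewrite -exprD -mulnDr ![w ^+ (j * _)]exprM -!exprM ![(j * _)%N]mulnC !exprM
    (expr_mod _ wn).
rewrite (@char_poly_similar _ _ _ (diag_mx d) (Vandermonde n.+1 a)).
- rewrite char_poly_trig; last exact/diag_mx_is_trig.
  by apply: eq_bigr => j _; rewrite !mxE eqxx mulr1n.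
- rewrite unitmxE det_Vandermonde unitfE.
  apply/prodf_neq0 => i _; apply/prodf_neq0 => j ij.
  rewrite !mxE subr_eq0 (inj_eq invr_inj) (eq_prim_root_expr prw).
  by rewrite !modn_small// gtn_eqF.
apply/matrixP => i j; rewrite mul_mx_diag !mxE mulr_sumr.
rewrite (reindex_inj (inv_inj (subKr i))); apply: eq_bigr => x _.
rewrite !mxE subKr mulrCA; congr (_ * _).
rewrite !exprVn -!exprM; apply: (canRL (mulKf _)); first by rewrite expf_neq0.
have := wD j (i - x) x; rewrite subrK => ->.
by rewrite mulrAC divff ?mul1r// expf_neq0.
Qed.

(** The choice of roots inside [eigenvalues] does not matter: the product of linear factors fixes
    them up to permutation. *)
Lemma energy_of_char_poly (R : realType) n (e : rel 'I_n) (lam : 'I_n -> R) :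
  char_poly (map_mx (real_complex R) (adjacency_mx R e))
    = \prod_j ('X - (real_complex R (lam j))%:P) ->
  energy R e = \sum_j `|lam j|.
Proof.
move=> charE; rewrite /energy /eigenvalues.
case: closed_field_poly_normal => rs /= rsE.
have := monicP (char_poly_monic (map_mx (real_complex R) (adjacency_mx R e))).
move=> lc1; move: rsE; rewrite lc1 scale1r charE => rsE.
have : perm_eq rs [seq real_complex R (lam j) | j <- index_enum 'I_n].
  by apply: prod_XsubC_eq; rewrite -rsE big_map.
move=> /(perm_big _) ->; rewrite big_map; apply: eq_bigr => j _.
by rewrite /= expr0n addr0 sqrtr_sqr.
Qed.

Lemma energy_circulant (R : realType) n (e : rel 'I_n) (f : nat -> R)
    (lam : 'I_n -> R) : (0 < n)%N ->
  (forall i j : 'I_n, (e i j)%:R = f ((i + (n - j)) %% n)%N) ->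
  (forall w : R[i], n.-primitive_root w -> forall j : 'I_n,
     \sum_(x < n) real_complex R (f x) * w ^+ (j * x) = real_complex R (lam j)) ->
  energy R e = \sum_j `|lam j|.
Proof.
case: n e lam => [//|n] e lam _ ef lamE; apply: energy_of_char_poly.
have [|w prw] := @prim_root_exists R[i] n.+1; first by rewrite pnatr_eq0.
under [RHS]eq_bigr => j _ do rewrite -(lamE w prw).
rewrite -(char_poly_circulant (fun x => real_complex R (f x)) prw).
congr char_poly; apply/matrixP => i j; rewrite !mxE ef /=.
by rewrite modnDmr.
Qed.

Lemma gcdn_ord_dist n (i j : 'I_n) :
  gcdn `|i%:Z - j%:Z| n = gcdn ((i + (n - j)) %% n) n.
Proof.
rewrite gcdn_modl; have := ltn_ord i; have := ltn_ord j => jn ln.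
have [ji|ij] := leqP j i.
  have -> : (i + (n - j) = (i - j) + n)%N by lia.
  by rewrite [RHS]gcdnC gcdnDr [RHS]gcdnC; congr gcdn; lia.
have -> : (i + (n - j) = n - (j - i))%N by lia.
have -> : `|i%:Z - j%:Z|%N = (j - i)%N by lia.
set k := (j - i)%N; have kn : (k <= n)%N by rewrite /k; lia.
transitivity (gcdn k (n - k)); first by rewrite -{1}(subnK kn) gcdnDr.
by rewrite gcdnC -{3}(subnK kn) gcdnDl.
Qed.

(** * Eigenvalues and energy for a prime power order *)

Section PrimePower.

Context {R : realType} (p s : nat).
Hypothesis p_prime : prime p.

Let p_gt0 : (0 < p)%N := prime_gt0 p_prime.
Let p_gt1 : (1 < p)%N := prime_gt1 p_prime.

(** The exponent [e] is the [p]-adic valuation of [y] capped at [s], so that [y = 0] is covered. *)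
Lemma dvdn_pfactor_gcd y : exists2 e, (e <= s)%N &
  gcdn y (p ^ s) = (p ^ e)%N /\ forall k, (k <= s)%N -> (p ^ k %| y)%N = (k <= e)%N.
Proof.
have /(dvdn_pfactor _ _ p_prime)[e es gE] := dvdn_gcdr y (p ^ s).
exists e => //; split=> // k ks.
by rewrite -(dvdn_Pexp2l _ _ p_gt1) -gE dvdn_gcd (dvdn_exp2l p ks) andbT.
Qed.

(* The exponents are reversed so that an eigenvalue at valuation u involves only
   the v <= u. *)
Definition exponent_pred (D : {set 'I_(p ^ s)}) : pred nat :=
  fun v => [exists d in D, val d == (p ^ (s - 1 - v))%N].

(** Adjacency is rewritten through indicators of divisibility, whose Fourier transforms are given by
    [prim_sum_dvd]. *)
Lemma gcd_mem_indicator (D : {set 'I_(p ^ s)}) y :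
  ([exists d in D, gcdn y (p ^ s) == d])%:R
  = \sum_(v < s | exponent_pred D v)
      ((p ^ (s - 1 - v) %| y)%N%:R - (p ^ (s - v) %| y)%N%:R) :> R.
Proof.
have [e es [gE dE]] := dvdn_pfactor_gcd y.
have indE (v : 'I_s) : (p ^ (s - 1 - v) %| y)%N%:R - (p ^ (s - v) %| y)%N%:R
   = (s - 1 - v == e)%N%:R :> R.
  have := ltn_ord v => vs; rewrite !dE ?leq_subr//; last by lia.
  have -> : (s - v <= e)%N = (s - 1 - v < e)%N by lia.
  by case: ltngtP; rewrite ?subrr ?subr0.
under eq_bigr do rewrite indE.
(* If [e = s] the gcd is [p ^ s], too large for an element of [D], and no [v] matches either. *)
rewrite gE; move: es; rewrite leq_eqVlt => /orP[/eqP eE|es].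
  rewrite big1 => [|v _]; last by have := ltn_ord v; case: eqP => //; lia.
  rewrite (_ : [exists _ in D, _] = false)//.
  apply/existsP => -[d /andP[_ /eqP]]; have := ltn_ord d.
  by rewrite eE => /[swap] <-; rewrite ltnn.
have u_s : (s - 1 - e < s)%N by lia.
have uE : (s - 1 - (s - 1 - e) = e)%N by lia.
rewrite big_mkcond (bigD1 (Ordinal u_s))//= big1 ?addr0 => [|v].
  rewrite uE eqxx /exponent_pred uE.
  under eq_existsb do rewrite eq_sym.
  by case: [exists _ in D, _].
move=> vu; case: ifP => // _; case: eqP => // ve.
by case/eqP: vu; apply: val_inj => /=; have := ltn_ord v; lia.
Qed.

Variable P : pred nat.

(** Each summand is the Ramanujan sum of modulus [p ^ v.+1] at [j]. *)
Definition eigenvalue_at (j : nat) : R :=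
  \sum_(v < s | P v)
    (p%:R ^+ v.+1 * (p ^ v.+1 %| j)%N%:R - p%:R ^+ v * (p ^ v %| j)%N%:R).

Lemma fourier_indicator (w : R[i]) (j : nat) : (p ^ s).-primitive_root w ->
  \sum_(x < p ^ s) real_complex R
     (\sum_(v < s | P v)
        ((p ^ (s - 1 - v) %| x)%N%:R - (p ^ (s - v) %| x)%N%:R)) * w ^+ (j * x)
  = real_complex R (eigenvalue_at j).
Proof.
move=> prw.
under eq_bigr do rewrite rmorph_sum mulr_suml /=.
rewrite exchange_big rmorph_sum /=; apply: eq_bigr => v _.
(* The transform of the multiples of [p ^ (s - k)] is [p ^ k] times the indicator of the multiples
   of [p ^ k]; it is used for [k = v.+1] and [k = v]. *)
have ind k : (k <= s)%N ->
    \sum_(x < p ^ s) (p ^ (s - k) %| x)%N%:R * w ^+ (j * x)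
    = real_complex R (p%:R ^+ k * (p ^ k %| j)%N%:R).
  move=> ks; have nE : (p ^ s = p ^ (s - k) * p ^ k)%N by rewrite -expnD subnK.
  under eq_bigr do rewrite mulr_natl mulrb; rewrite -big_mkcond.
  rewrite (prim_sum_dvd j prw nE) -natrX rmorphM /= !rmorph_nat.
  by case: (_ %| _)%N; rewrite ?mulr1 ?mulr0.
have vs := ltn_ord v.
rewrite [RHS]rmorphB /= -!ind//; last exact: ltnW.
rewrite -sumrB; apply: eq_bigr => x _.
by rewrite rmorphB /= !rmorph_nat mulrBl subnAC subn1 subnS.
Qed.

Lemma sum_dvdn_indicator v : (v <= s)%N ->
  \sum_(j < p ^ s) (p ^ v %| j)%N%:R = p%:R ^+ (s - v) :> R.
Proof.
move=> vs; rewrite -natr_sum -natrX; congr _%:R.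
rewrite -[RHS](@count_dvdn (p ^ v)) ?expn_gt0 ?p_gt0// -expnD subnKC//.
by rewrite [RHS]big_mkcond; apply: eq_bigr => j _; case: (_ %| _)%N.
Qed.

(** For each [v] the two terms both sum to [p ^ s]; this is the vanishing trace. *)
Lemma sum_eigenvalue_at : \sum_(j < p ^ s) eigenvalue_at j = 0.
Proof.
rewrite exchange_big big1 //= => v _; have vs := ltn_ord v.
rewrite sumrB -!mulr_sumr !sum_dvdn_indicator// 1?ltnW//.
by rewrite -!exprD subnKC// subnKC ?subrr// ltnW.
Qed.

Let S v : R := \sum_(k < v | P k) p%:R ^+ k.

(** The extreme case is [P] full, with left side [p ^ v - 1]. This decides the sign of the
    eigenvalues. *)
Lemma geometric_subsum_lt v : (p%:R - 1) * S v < p%:R ^+ v.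
Proof.
have p1 : 1 < p%:R :> R by rewrite ltr1n.
elim: v => [|v IH]; first by rewrite /S big_ord0 mulr0 expr0.
rewrite /S (big_ord_recr_cond +%R P (fun k => p%:R ^+ k)) -/(S v) /= exprS.
have pv0 : 0 < p%:R ^+ v :> R by rewrite exprn_gt0// ltr0n.
case: (P v); first by nra.
by rewrite addr0; nra.
Qed.

Lemma norm_eigenvalue_at (j : 'I_(p ^ s)) :
  `|eigenvalue_at j| = eigenvalue_at j
     - 2 * \sum_(v < s | P v) ((p%:R - 1) * S v - p%:R ^+ v)
             * ((p ^ v %| j)%N%:R - (p ^ v.+1 %| j)%N%:R).
Proof.
have [u us [_ dE]] := dvdn_pfactor_gcd j.
have p1 : 1 < p%:R :> R by rewrite ltr1n.
have S0 : 0 <= (p%:R - 1) * S u.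
  by rewrite mulr_ge0 ?subr_ge0 ?(ltW p1)// /S sumr_ge0// => i _; rewrite exprn_ge0.
(* The sum reduces to the valuation [u] of [j]; for [j = 0], where [u = s], it is empty. *)
have pick (G : nat -> R) : \sum_(v < s | P v) G v * (nat_of_ord v == u)%:R
    = if (u < s)%N && P u then G u else 0.
  have [us'|us'] /= := ltnP u s; last first.
    rewrite big1// => v _; have := ltn_ord v.
    by case: eqP => [->|_]; rewrite ?mulr0// ltnNge us'.
  rewrite big_mkcond (bigD1 (Ordinal us'))//= big1 ?addr0 => [|v vu].
    by rewrite eqxx mulr1.
  have /negbTE -> : nat_of_ord v != u by apply: contra vu => /eqP vu; apply/eqP/val_inj.
  by rewrite mulr0; case: ifP.
(* Indices [v < u] contribute [(p - 1) p ^ v], [v = u] contributes [- p ^ u], and [v > u]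
   nothing. *)
have eigE : eigenvalue_at j = (p%:R - 1) * S u
     - (if (u < s)%N && P u then p%:R ^+ u else 0).
  rewrite -pick /S (big_ord_widen_cond s P (fun k => p%:R ^+ k) us) mulr_sumr.
  rewrite big_mkcondr -sumrB /=; apply: eq_bigr => v _; have vs := ltn_ord v.
  rewrite (dE v.+1 vs) (dE v (ltnW vs)) exprS; case: ltngtP => _ /=; ring.
have -> : \sum_(v < s | P v) ((p%:R - 1) * S v - p%:R ^+ v)
             * ((p ^ v %| j)%N%:R - (p ^ v.+1 %| j)%N%:R)
    = if (u < s)%N && P u then (p%:R - 1) * S u - p%:R ^+ u else 0.
  rewrite -(pick (fun v => (p%:R - 1) * S v - p%:R ^+ v)).
  apply: eq_bigr => v _; have vs := ltn_ord v.
  rewrite (dE v.+1 vs) (dE v (ltnW vs)); congr (_ * _); case: ltngtP => _ /=; ring.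
rewrite eigE; have := geometric_subsum_lt u.
case: ifP => _ lt; last by rewrite subr0 mulr0 subr0 ger0_norm.
rewrite ltr0_norm; first by ring.
by rewrite subr_lt0.
Qed.

(** Only the correction by twice the negative eigenvalues survives; valuation [v] occurs for
    [(p - 1) p ^ (s - 1 - v)] frequencies. *)
Lemma sum_norm_eigenvalue_at :
  \sum_(j < p ^ s) `|eigenvalue_at j|
  = 2 * (p%:R - 1) * p%:R ^+ (s - 1)
      * \sum_(v < s | P v) (1 - (p%:R - 1) * (S v / p%:R ^+ v)).
Proof.
under eq_bigr do rewrite norm_eigenvalue_at.
rewrite sumrB sum_eigenvalue_at -mulr_sumr exchange_big /= sub0r.
rewrite -mulrN -!mulrA; congr (2 * _); rewrite -sumrN !mulr_sumr.
apply: eq_bigr => v _; have vs := ltn_ord v.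
rewrite -mulr_sumr sumrB !sum_dvdn_indicator//; last exact: ltnW.
have -> : (s - v = (s - v.+1).+1)%N by lia.
have -> : (s - 1 = (s - v.+1) + v)%N by lia.
rewrite exprS exprD; field.
by rewrite expf_neq0// pnatr_eq0 -lt0n.
Qed.

End PrimePower.

(** * From divisor sets to exponents, and the maximum *)

Lemma card_exponent_pred p s (D : {set 'I_(p ^ s)}) :
  prime p -> D \subset proper_divisors (p ^ s) ->
  (\sum_(v < s | exponent_pred D v) 1)%N = #|D|.
Proof.
move=> p_prime sD; have p_gt1 := prime_gt1 p_prime.
have gP (v : 'I_s) : (p ^ (s - 1 - v) < p ^ s)%N.
  by rewrite ltn_exp2l//; have := ltn_ord v; lia.
pose g v := Ordinal (gP v).
have g_inj : injective g.
  move=> u v /(congr1 val) /= /eqP; rewrite eqn_exp2l// => /eqP uv.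
  by apply: val_inj => /=; have := ltn_ord u; have := ltn_ord v; lia.
rewrite sum1dep_card -(card_imset _ g_inj); apply: eq_card => d.
apply/imsetP/idP => [[v]|dD].
  rewrite inE => /existsP[d' /andP[d'D /eqP d'E]] ->.
  by rewrite (_ : g v = d')//; apply: val_inj.
have := subsetP sD d dD; rewrite inE => /andP[d0].
case/(dvdn_pfactor _ _ p_prime) => m ms dE.
have {}ms : (m < s)%N by have := ltn_ord d; rewrite dE ltn_exp2l.
have vs : (s - 1 - m < s)%N by lia.
have vE : (s - 1 - (s - 1 - m) = m)%N by lia.
exists (Ordinal vs); last by apply: val_inj; rewrite /= vE.
by rewrite inE; apply/existsP; exists d; rewrite dD /= vE dE.
Qed.

Lemma energy_icg_prime_power (R : realType) p s (D : {set 'I_(p ^ s)}) :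
  prime p ->
  energy R (icg D)
  = 2 * (p%:R - 1) * p%:R ^+ (s - 1)
      * \sum_(v < s | exponent_pred D v)
          (1 - (p%:R - 1)
            * ((\sum_(k < v | exponent_pred D k) p%:R ^+ k) / p%:R ^+ v)).
Proof.
move=> p_prime; rewrite -sum_norm_eigenvalue_at//.
apply: (@energy_circulant R _ _ (fun x => ([exists d in D, gcdn x (p ^ s) == d])%:R)).
- by rewrite expn_gt0 prime_gt0.
- by move=> i j; rewrite /icg gcdn_ord_dist.
move=> w prw j; rewrite -(fourier_indicator _ _ prw)//.
by apply: eq_bigr => x _; rewrite gcd_mem_indicator.
Qed.

Theorem theorem2 (R : realType) (p r s : nat)
  (hp : prime p) (hr : (2 <= r)%N) (hrs : (r <= s)%N) :
  exists nu : R,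
    unique (nu_equation p (s - 1) r) nu /\
    Emax R r (p ^ s) <=
      2 * (p%:R - 1) * p%:R ^+ (s - 1) *
      (r%:R - (p%:R - 1) * (r%:R - 1 + mu_tilde nu) * mu_tilde nu).
Proof.
have p0 := prime_gt0 hp.
have p1 : 1 <= p%:R :> R by rewrite ler1n.
have [nu [nu01 nuU]] := @nu_equation_exists_unique R p (s - 1) r p0 hr.
exists nu; split=> //; have [[_ nuE] _] := nuU.
have c0 : 0 <= 2 * (p%:R - 1) * p%:R ^+ (s - 1) :> R.
  by rewrite !mulr_ge0 ?subr_ge0 ?exprn_ge0 ?ler0n.
have bound (P : pred nat) : (\sum_(v < s | P v) 1)%N = r ->
    \sum_(v < s | P v) (1 - (p%:R - 1)
       * ((\sum_(k < v | P k) p%:R ^+ k) / p%:R ^+ v))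
    <= r%:R - (p%:R - 1) * (r%:R - 1 + mu_tilde nu) * mu_tilde nu.
  move=> Pr; have rE : \sum_(v < s | P v) 1 = r%:R :> R by rewrite -Pr natr_sum.
  rewrite sumrB rE lerD2l lerN2 -mulr_sumr -mulrA.
  rewrite ler_wpM2l ?subr_ge0//.
  exact: prime_power_pair_sum_ge.
rewrite /Emax; apply: bigmax_le => [|D /andP[sD /eqP cardD]].
  (* The default 0 of the maximum must lie below the bound too: the exponents [v < r], of which
     there are [r] as [r <= s], give a nonnegative sum below it. *)
  rewrite mulr_ge0//; apply: le_trans (bound (fun v => v < r)%N _).
    apply: sumr_ge0 => v _; rewrite mulrA subr_ge0 ler_pdivrMr ?exprn_gt0 ?ltr0n//.
    by rewrite mul1r; apply/ltW/(geometric_subsum_lt hp (fun k => k < r)%N).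
  by rewrite -(big_ord_widen s (fun=> 1%N) hrs) sum1_card card_ord.
rewrite energy_icg_prime_power// ler_wpM2l// bound//.
by rewrite card_exponent_pred.
Qed.
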